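(* The Bohl dichotomy spectrum $\Sigma_{\mathrm{BD}}(A)$ of the system $x(n+1)=A(n)x(n)$, $n\in\mathbb{N}$, is the nonempty disjoint union of at most $d$ compact intervals $$\Sigma_{\mathrm{BD}}(A)=[\alpha_1,\beta_1]\cup\dots\cup[\alpha_\ell,\beta_\ell],$$ where $\alpha_1\le\beta_1<\alpha_2\le\beta_2<\dots<\alpha_\ell\le\beta_\ell$ and $\ell\in\{1,\dots,d\}$. Moreover, there exists a corresponding filtration of linear subspaces $$\{0\}=V_0\subsetneq V_1\subsetneq\cdots\subsetneq V_\ell=\mathbb{R}^d$$ satisfying, for $i\in\{0,\dots,\ell\}$, $$V_i=\{x_0\in\mathbb{R}^d:\lim_{n\to\infty}x(n,x_0)\mathrm{e}^{-\gamma n}=0\}\quad\text{for each }\gamma\in(\beta_i,\alpha_{i+1}),$$ with $\beta_0:=-\infty$ and $\alpha_{\ell+1}:=\infty$.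
   Context: Here $\mathbb{N}=\{0,1,2,\dots\}$, $d\ge 1$, and $A=(A(n))_{n\in\mathbb{N}}$ is a Lyapunov sequence: each $A(n)\in\mathbb{R}^{d\times d}$ is invertible and both $(A(n))_{n\in\mathbb{N}}$ and $(A(n)^{-1})_{n\in\mathbb{N}}$ are bounded. For $x_0\in\mathbb{R}^d$, $x(\cdot,x_0)$ denotes the solution of $x(n+1)=A(n)x(n)$ with $x(0,x_0)=x_0$. A system $x(n+1)=A(n)x(n)$ has a Bohl dichotomy if there exist subspaces $L_1,L_2\subseteq\mathbb{R}^d$ with $\mathbb{R}^d=L_1\oplus L_2$, $\alpha>0$ and functions $C_1,C_2:\mathbb{R}^d\to(0,\infty)$ such that $\|x(n,x_0)\|\le C_1(x_0)\mathrm{e}^{-\alpha(n-m)}\|x(m,x_0)\|$ for all $x_0\in L_1$, $n\ge m$, and $\|x(n,x_0)\|\ge C_2(x_0)\mathrm{e}^{\alpha(n-m)}\|x(m,x_0)\|$ for all $x_0\in L_2$, $n\ge m$ ($n,m\in\mathbb{N}$). The Bohl dichotomy spectrum is $\Sigma_{\mathrm{BD}}(A)=\{\gamma\in\mathbb{R}: x(n+1)=\mathrm{e}^{-\gamma}A(n)x(n)\text{ has no Bohl dichotomy}\}$. *)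

(* Defs.v *)
From mathcomp Require Import all_boot all_order all_algebra.
From mathcomp Require Import all_classical all_reals all_analysis.
Set Implicit Arguments.
Unset Strict Implicit.
Unset Printing Implicit Defensive.
Import Order.TTheory GRing.Theory Num.Theory.
Import numFieldNormedType.Exports.
Local Open Scope classical_set_scope.
Local Open Scope ring_scope.

(* `|_| on matrices and column vectors is the library's norm, i.e. the maximum
   of the absolute values of the entries; all notions below are unchanged if it
   is replaced by another norm. *)

Definition lyapunov_sequence (R : realType) (d : nat) (A : nat -> 'M[R]_d) : Prop :=
  [/\ forall n, A n \in unitmx,
      [bounded A n | n in [set: nat]]
    & [bounded invmx (A n) | n in [set: nat]]].

Fixpoint solution (R : realType) (d : nat) (A : nat -> 'M[R]_d)
    (x0 : 'cV[R]_d) (n : nat) : 'cV[R]_d :=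
  if n is k.+1 then A k *m solution A x0 k else x0.

Definition bohl_dichotomy (R : realType) (d : nat) (A : nat -> 'M[R]_d) : Prop :=
  exists (L1 L2 : {vspace 'cV[R]_d}) (alpha : R) (C1 C2 : 'cV[R]_d -> R),
    [/\ (L1 + L2)%VS = fullv /\ (L1 :&: L2)%VS = 0%VS,
        0 < alpha,
        forall x0, 0 < C1 x0 /\ 0 < C2 x0,
        forall x0, x0 \in L1 -> forall n m : nat, (m <= n)%N ->
          `|solution A x0 n|
            <= C1 x0 * expR (- alpha * (n - m)%N%:R) * `|solution A x0 m|
      & forall x0, x0 \in L2 -> forall n m : nat, (m <= n)%N ->
          `|solution A x0 n|
            >= C2 x0 * expR (alpha * (n - m)%N%:R) * `|solution A x0 m|].

Definition bohl_spectrum (R : realType) (d : nat) (A : nat -> 'M[R]_d) : set R :=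
  [set gamma | ~ bohl_dichotomy (fun n => expR (- gamma) *: A n)].

(* The spectral gaps ]beta_i, alpha_{i+1}[ for 0 <= i <= l, with the conventions
   beta_0 = -oo and alpha_{l+1} = +oo. The values of alpha and beta outside
   {1, ..., l} are never used. *)
Definition spectral_gap (R : realType) (l : nat) (alpha beta : nat -> R)
    (i : nat) : set R :=
  [set gamma |
    ((if (i == 0)%N then -oo else (beta i)%:E) < gamma%:E)%E /\
    (gamma%:E < (if (i == l)%N then +oo else (alpha i.+1)%:E))%E].

(* Main.v *)
(* If the system scaled by [expR (- gamma)] has a Bohl dichotomy, its decaying
   space is exactly the set of initial values whose scaled solutions tend to 0;
   hence it is determined by gamma and increases with gamma. The dichotomy with
   its two subspaces persists for nearby gamma, and if two values of gamma share
   their decaying space then so does every value between them. Since the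
   coefficients and their inverses are bounded, this space is 0 for small gamma
   and everything for large gamma. So the resolvent set is a union of disjoint
   open intervals, one for each dimension that occurs, of which there are at
   most d + 1, the first unbounded below and the last unbounded above; the
   spectrum consists of the compact intervals between consecutive ones. *)

Require Import Defs.
From mathcomp Require Import all_boot all_order all_algebra.
From mathcomp Require Import all_classical all_reals all_analysis.
From mathcomp Require Import ring.
Import Order.TTheory GRing.Theory Num.Theory.
Import numFieldNormedType.Exports.
Local Open Scope classical_set_scope.
Local Open Scope ring_scope.

(** * Solutions, scaling and the norm *)

Lemma solution0 {R : realType} {d : nat} (A : nat -> 'M[R]_d) (n : nat) :
  solution A 0 n = 0.
Proof. by elim: n => //= n ->; rewrite mulmx0. Qed.

Lemma solutionD {R : realType} {d : nat} (A : nat -> 'M[R]_d) (x y : 'cV[R]_d)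
    (n : nat) :
  solution A (x + y) n = solution A x n + solution A y n.
Proof. by elim: n => //= n ->; rewrite mulmxDr. Qed.

Lemma solution_scale {R : realType} {d : nat} (A : nat -> 'M[R]_d) (c : R)
    (x : 'cV[R]_d) (n : nat) :
  solution (fun k => c *: A k) x n = c ^+ n *: solution A x n.
Proof.
elim: n => [|n IHn] /=; first by rewrite expr0 scale1r.
by rewrite IHn -scalemxAl -scalemxAr scalerA exprS.
Qed.

Lemma norm_solution_scale {R : realType} {d : nat} (A : nat -> 'M[R]_d)
    (gamma : R) (x : 'cV[R]_d) (n : nat) :
  `|solution (fun k => expR (- gamma) *: A k) x n| =
  expR (- gamma * n%:R) * `|solution A x n|.
Proof.
by rewrite solution_scale normrZ expRM_natr ger0_norm// exprn_ge0// expR_ge0.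
Qed.

(** Each entry of the product is a sum of [q] terms, each at most the product of the two maximum
    norms; hence the factor [q]. *)
Lemma norm_mulmx_le {R : realType} {p q : nat} (M : 'M[R]_(p, q))
    (v : 'cV[R]_q) :
  `|M *m v| <= q%:R * `|M| * `|v|.
Proof.
have entry_le (m n : nat) (B : 'M[R]_(m, n)) i j : `|B i j| <= `|B|.
  rewrite [leRHS]/Num.norm/= mx_normrE.
  exact: (le_bigmax _ (fun ij => `|B ij.1 ij.2|) (i, j)).
rewrite [leLHS]/Num.norm/= mx_normrE; apply/bigmax_leP; split=> [|[i j] _ /=].
  by rewrite !mulr_ge0.
rewrite mxE (le_trans (ler_norm_sum _ _ _))//.
have -> : q%:R * `|M| * `|v| = \sum_(k < q) `|M| * `|v|.
  by rewrite sumr_const card_ord -mulrA mulr_natl.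
rewrite ler_sum// => k _.
by rewrite normrM ler_pM.
Qed.

(** * Rates of decay and growth *)

(** The constant depends on the initial value, as in a Bohl dichotomy, and [delta] may have either
    sign. Positivity is asked for outside [L] too, so that [C] can serve directly in
    [bohl_dichotomy]. *)
Definition decays {R : realType} {d : nat} (A : nat -> 'M[R]_d)
    (L : {vspace 'cV[R]_d}) (delta : R) :=
  exists C : 'cV[R]_d -> R, forall x0, 0 < C x0 /\
    (x0 \in L -> forall n m : nat, (m <= n)%N ->
      `|solution A x0 n| <=
        C x0 * expR (delta * (n - m)%N%:R) * `|solution A x0 m|).

Definition grows {R : realType} {d : nat} (A : nat -> 'M[R]_d)
    (L : {vspace 'cV[R]_d}) (delta : R) :=
  exists C : 'cV[R]_d -> R, forall x0, 0 < C x0 /\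
    (x0 \in L -> forall n m : nat, (m <= n)%N ->
      `|solution A x0 n| >=
        C x0 * expR (delta * (n - m)%N%:R) * `|solution A x0 m|).

(* The dichotomy of the system scaled by [expR (- gamma)] with decaying space
   [L], read off the unscaled system: the rates lie strictly on the two sides of
   gamma, so that varying gamma needs no rescaling. *)
Definition splits {R : realType} {d : nat} (A : nat -> 'M[R]_d)
    (gamma : R) (L : {vspace 'cV[R]_d}) :=
  exists L2 : {vspace 'cV[R]_d},
    [/\ (L + L2)%VS = fullv, (L :&: L2)%VS = 0%VS,
      exists2 delta, delta < gamma & decays A L delta
    & exists2 delta, gamma < delta & grows A L2 delta].

Definition stable_set {R : realType} {d : nat} (A : nat -> 'M[R]_d) (gamma : R)
    : set 'cV[R]_d :=
  [set x0 | expR (- gamma * n%:R) *: solution A x0 n @[n --> \oo]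
              --> (0 : 'cV[R]_d)].

Lemma ler_expR_natM (R : realType) (a b : R) (n : nat) :
  a <= b -> expR (a * n%:R) <= expR (b * n%:R).
Proof. by move=> ab; rewrite ler_expR ler_wpM2r. Qed.

Lemma decaysW {R : realType} {d : nat} (A : nat -> 'M[R]_d)
    (L : {vspace 'cV[R]_d}) (delta delta' : R) :
  delta <= delta' -> decays A L delta -> decays A L delta'.
Proof.
move=> dd' [C hC]; exists C => x0; have [C0 h] := hC x0; split=> // xL n m mn.
apply: le_trans (h xL n m mn) _; rewrite ler_wpM2r// ler_wpM2l ?(ltW C0)//.
exact: ler_expR_natM.
Qed.

Lemma growsW {R : realType} {d : nat} (A : nat -> 'M[R]_d)
    (L : {vspace 'cV[R]_d}) (delta delta' : R) :
  delta' <= delta -> grows A L delta -> grows A L delta'.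
Proof.
move=> dd' [C hC]; exists C => x0; have [C0 h] := hC x0; split=> // xL n m mn.
apply: le_trans _ (h xL n m mn); rewrite ler_wpM2r// ler_wpM2l ?(ltW C0)//.
exact: ler_expR_natM.
Qed.

(** Factoring out [expR (- gamma * n%:R)] turns an estimate for the scaled system into one for the
    unscaled system, with the rate shifted by [gamma]. *)
Lemma expR_shift (R : realType) (gamma a C x : R) (n m : nat) : (m <= n)%N ->
  C * expR (a * (n - m)%N%:R) * (expR (- gamma * m%:R) * x) =
  expR (- gamma * n%:R) * (C * expR ((gamma + a) * (n - m)%N%:R) * x).
Proof.
move=> mn.
have -> : (gamma + a) * (n - m)%N%:R =
    a * (n - m)%N%:R + - gamma * m%:R - - gamma * n%:R.
  by rewrite natrB//; ring.
by rewrite expRD expRN expRD; field; rewrite gt_eqF// expR_gt0.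
Qed.

Lemma bohl_dichotomy_scaleP {R : realType} {d : nat} (A : nat -> 'M[R]_d)
    (gamma : R) :
  bohl_dichotomy (fun n => expR (- gamma) *: A n) <->
  exists L, splits A gamma L.
Proof.
split.
- move=> [L1 [L2 [alpha [C1 [C2 [[LD LI] alpha0 C0 h1 h2]]]]]].
  exists L1, L2; split=> //.
  + exists (gamma - alpha); first by rewrite ltrBlDr ltrDl.
    exists C1 => x0; split=> [|xL n m mn]; first by have [] := C0 x0.
    have := h1 _ xL n m mn.
    by rewrite !norm_solution_scale expR_shift// ler_pM2l// expR_gt0.
  + exists (gamma + alpha); first by rewrite ltrDl.
    exists C2 => x0; split=> [|xL n m mn]; first by have [] := C0 x0.
    have := h2 _ xL n m mn.
    by rewrite !norm_solution_scale expR_shift// ler_pM2l// expR_gt0.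
- move=> [L1 [L2 [LD LI [d1 d1g h1] [d2 d2g h2]]]].
  (* A Bohl dichotomy has one rate for both subspaces: the smaller distance from [gamma]. *)
  pose alpha := Num.min (gamma - d1) (d2 - gamma).
  have [C1 {}h1] : decays A L1 (gamma - alpha).
    by apply: decaysW h1; rewrite lerBrDl -lerBrDr ge_min lexx.
  have [C2 {}h2] : grows A L2 (gamma + alpha).
    by apply: growsW h2; rewrite -lerBrDl ge_min lexx orbT.
  exists L1, L2, alpha, C1, C2; split=> //.
  + by rewrite lt_min !subr_gt0 d1g d2g.
  + by move=> x0; have [? _] := h1 x0; have [? _] := h2 x0.
  + move=> x0 xL n m mn; have [_ /(_ xL n m mn)] := h1 x0.
    by rewrite !norm_solution_scale expR_shift// ler_pM2l// expR_gt0.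
  + move=> x0 xL n m mn; have [_ /(_ xL n m mn)] := h2 x0.
    by rewrite !norm_solution_scale expR_shift// ler_pM2l// expR_gt0.
Qed.

(** * The decaying space as a set of stable initial values *)

(** Compared with time 0, the scaled solution is dominated by a geometric sequence of ratio
    [expR (delta - gamma) < 1]. *)
Lemma decays_stable {R : realType} {d : nat} {A : nat -> 'M[R]_d}
    {L : {vspace 'cV[R]_d}} {delta gamma : R} {x0 : 'cV[R]_d} :
  decays A L delta -> delta < gamma -> x0 \in L -> stable_set A gamma x0.
Proof.
move=> [C hC] dg xL; have [C0 {hC}/(_ xL) h] := hC x0.
apply/norm_cvg0P.
apply: (@squeeze_cvgr _ _ _ _ (fun=> 0)
  (geometric (C x0 * `|x0|) (expR (delta - gamma)))); last 2 first.
- exact: cvg_cst.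
- by apply: cvg_geometric; rewrite ger0_norm ?expR_ge0// expR_lt1 subr_lt0.
near=> n; rewrite normr_ge0/= normrZ ger0_norm ?expR_ge0//.
have := h n 0%N isT; rewrite subn0 /= => hn.
apply: le_trans (ler_wpM2l (expR_ge0 _) hn) _.
rewrite -expRM_natr mulrBl -mulNr expRD le_eqVlt; apply/orP; left.
by apply/eqP; ring.
Unshelve. all: by end_near. Qed.

(** If [x0] were nonzero, the norm of its scaled solution would stay above the positive constant
    [C x0] times the norm of [x0]. *)
Lemma grows_stable0 {R : realType} {d : nat} {A : nat -> 'M[R]_d}
    {L : {vspace 'cV[R]_d}} {delta gamma : R} {x0 : 'cV[R]_d} :
  grows A L delta -> gamma <= delta -> x0 \in L -> stable_set A gamma x0 ->
  x0 = 0.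
Proof.
move=> /growsW/[apply] -[C hC] xL xS; have [C0 {hC}/(_ xL) h] := hC x0.
apply/eqP; apply: contrapT => /negP x_neq0.
have Cx0 : 0 < C x0 * `|x0| by rewrite mulr_gt0// normr_gt0.
have [N _ /(_ N (leqnn N))/=] := cvgr0_norm_lt _ xS _ Cx0.
rewrite normrZ ger0_norm ?expR_ge0// ltNge => /negP; apply.
have := h N 0%N isT; rewrite subn0 /= => hN.
apply: le_trans (ler_wpM2l (expR_ge0 _) hN).
rewrite mulNr expRN le_eqVlt; apply/orP; left; apply/eqP; field.
by rewrite gt_eqF// expR_gt0.
Qed.

(** Write a stable [x] as [u + v] along the direct sum. Then [v = x - u] is stable as a difference
    of stable vectors and lies in the growing space, so it vanishes. *)
Lemma splits_stable {R : realType} {d : nat} {A : nat -> 'M[R]_d} {gamma : R}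
    {L : {vspace 'cV[R]_d}} :
  splits A gamma L -> [set x0 | x0 \in L] = stable_set A gamma.
Proof.
move=> [L2 [LD _ [d1 d1g h1] [d2 d2g h2]]]; apply/seteqP; split=> x /=.
  exact: decays_stable h1 d1g.
move=> xS; have /memv_addP[u uL [v vL xE]] : x \in (L + L2)%VS.
  by rewrite LD memvf.
suff -> : x = u by [].
rewrite xE (grows_stable0 h2 (ltW d2g) vL) ?addr0//.
have uS := decays_stable h1 d1g uL.
have xuS := cvgB xS uS; rewrite subr0 in xuS.
rewrite /stable_set /=.
apply: cvg_trans (xuS _).
apply: near_eq_cvg; apply: nearW => n.
by rewrite !fctE xE solutionD scalerDr addrAC subrr add0r.
Qed.

(** * Dependence of the splitting on [gamma] *)

(** A decay rate below [gamma] is also below [gamma'], so [L] lies in the stable set of [gamma'],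
    which is [L']. *)
Lemma splits_le {R : realType} {d : nat} {A : nat -> 'M[R]_d}
    {gamma gamma' : R} {L L' : {vspace 'cV[R]_d}} :
  splits A gamma L -> splits A gamma' L' -> gamma <= gamma' -> (L <= L')%VS.
Proof.
move=> [L2 [_ _ [d1 d1g h1] _]] /splits_stable h' gg'.
apply/subvP => x xL; suff: [set x0 | x0 \in L'] x by [].
by rewrite h'; apply: decays_stable h1 (lt_le_trans d1g gg') xL.
Qed.

(** The two rates themselves bound the interval: they serve every value strictly between them. *)
Lemma splits_open {R : realType} {d : nat} {A : nat -> 'M[R]_d}
    {gamma : R} {L : {vspace 'cV[R]_d}} :
  splits A gamma L -> exists a b : R, [/\ a < gamma, gamma < b &
    forall gamma', a < gamma' < b -> splits A gamma' L].
Proof.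
move=> [L2 [LD LI [d1 d1g h1] [d2 d2g h2]]]; exists d1, d2; split=> //.
by move=> g /andP[? ?]; exists L2; split=> //; [exists d1|exists d2].
Qed.

(* The decay of [L] is inherited from the left end, the growth of a complement
   of [L] from the right end. *)
Lemma splits_convex {R : realType} {d : nat} {A : nat -> 'M[R]_d}
    {gamma gamma' gamma'' : R} {L : {vspace 'cV[R]_d}} :
  splits A gamma L -> splits A gamma' L -> gamma <= gamma'' <= gamma' ->
  splits A gamma'' L.
Proof.
move=> [_ [_ _ [d1 d1g h1] _]] [L2 [LD LI _ [d2 d2g h2]]] /andP[gg'' g''g'].
exists L2; split=> //; first by exists d1 => //; exact: lt_le_trans gg''.
by exists d2 => //; exact: le_lt_trans d2g.
Qed.

(** * Splittings for very large and very small [gamma] *)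

Lemma solution_iter_le {R : realType} {d : nat} (A : nat -> 'M[R]_d) (M : R)
    (x : 'cV[R]_d) (n m : nat) :
  0 <= M -> (forall k (v : 'cV[R]_d), `|A k *m v| <= M * `|v|) -> (m <= n)%N ->
  `|solution A x n| <= M ^+ (n - m) * `|solution A x m|.
Proof.
move=> M0 hM /subnK; move: (n - m)%N => k <-.
elim: k => [|k IHk]; first by rewrite expr0 mul1r.
rewrite addSn /= (le_trans (hM _ _))// exprS -mulrA ler_wpM2l//.
Qed.

Lemma solution_iter_ge {R : realType} {d : nat} (A : nat -> 'M[R]_d) (M : R)
    (x : 'cV[R]_d) (n m : nat) :
  0 <= M -> (forall k (v : 'cV[R]_d), M * `|v| <= `|A k *m v|) -> (m <= n)%N ->
  M ^+ (n - m) * `|solution A x m| <= `|solution A x n|.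
Proof.
move=> M0 hM /subnK; move: (n - m)%N => k <-.
elim: k => [|k IHk]; first by rewrite expr0 mul1r.
by rewrite addSn /= (le_trans _ (hM _ _))// exprS -mulrA ler_wpM2l.
Qed.

Lemma bounded_mulmx {R : realType} {d : nat} {A : nat -> 'M[R]_d} :
  [bounded A n | n in [set: nat]] ->
  exists2 M : R, 0 < M & forall n (v : 'cV[R]_d), `|A n *m v| <= M * `|v|.
Proof.
(* Boundedness makes every number above [M] a bound, but [M] may be negative; [K] is such a number
   and positive. *)
move=> [M [_ hM]]; pose K := `|M| + 1.
have K0 : 0 < K by rewrite ltr_wpDl.
have hK n : `|A n| <= K.
  by apply: (hM K _ n I); rewrite (le_lt_trans (ler_norm M))// ltrDl.
(* The summand 1 keeps the constant positive also for [d = 0]. *)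
exists (d%:R * K + 1) => [|n v]; first by rewrite ltr_wpDl// mulr_ge0// ltW.
rewrite (le_trans (norm_mulmx_le _ _))// ler_wpM2r//.
by rewrite (le_trans (ler_wpM2l _ (hK n)))// lerDl.
Qed.

(** If one step multiplies norms by at most [M], every solution has rate at most [ln M]; the
    complement is the zero space, which grows at any rate. *)
Lemma splits_large {R : realType} {d : nat} {A : nat -> 'M[R]_d} :
  lyapunov_sequence A ->
  exists b : R, forall gamma, b < gamma -> splits A gamma fullv.
Proof.
move=> [_ /bounded_mulmx[M M0 hM] _]; exists (ln M) => gamma bg.
exists 0%VS; split; rewrite ?addv0 ?capv0//.
- exists (ln M) => //; exists (fun=> 1) => x0; split=> // _ n m mn.
  rewrite mul1r expRM_natr lnK ?posrE//.
  by apply: solution_iter_le => //; exact: ltW.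
- exists (gamma + 1); first by rewrite ltrDl.
  exists (fun=> 1) => x0; split=> //; rewrite memv0 => /eqP -> n m _.
  by rewrite !solution0 normr0 mulr0.
Qed.

Lemma splits_small {R : realType} {d : nat} {A : nat -> 'M[R]_d} :
  lyapunov_sequence A ->
  exists a : R, forall gamma, gamma < a -> splits A gamma 0%VS.
Proof.
move=> [uA _ /bounded_mulmx[M M0 hM]]; exists (ln M^-1) => gamma ga.
exists fullv; split; rewrite ?add0v ?cap0v//.
- exists (gamma - 1); first by rewrite ltrBlDr ltrDl.
  exists (fun=> 1) => x0; split=> //; rewrite memv0 => /eqP -> n m _.
  by rewrite !solution0 normr0 mulr0.
- exists (ln M^-1) => //; exists (fun=> 1) => x0; split=> // _ n m mn.
  rewrite mul1r expRM_natr lnK ?posrE ?invr_gt0//.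
  apply: solution_iter_ge => //; first by rewrite invr_ge0 ltW.
  (* Since [v] is the inverse of [A k] applied to [A k *m v], the bound on the inverses bounds [A k]
     from below. *)
  by move=> k v; rewrite mulrC ler_pdivrMr// mulrC -[in leLHS](mulKmx (uA k) v).
Qed.

(** * Enumeration of the stable subspaces *)

(* The possible stable subspaces are separated by their dimensions, so listing
   the dimensions that occur lists the subspaces. *)
Lemma splits_chain {R : realType} {d : nat} {A : nat -> 'M[R]_d} :
  (1 <= d)%N -> lyapunov_sequence A ->
  exists (l : nat) (V : nat -> {vspace 'cV[R]_d}),
    [/\ (1 <= l <= d)%N, V 0%N = 0%VS, V l = fullv,
      forall i j, (i < j <= l)%N -> (\dim (V i) < \dim (V j))%N
    & (forall i, (i <= l)%N -> exists gamma, splits A gamma (V i)) /\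
      forall gamma L, splits A gamma L -> exists2 i, (i <= l)%N & L = V i].
Proof.
move=> hd hA; have [a /(_ (a - 1)) low] := splits_small hA.
have [b /(_ (b + 1)) high] := splits_large hA.
pose D j := exists gamma L, splits A gamma L /\ \dim L = j.
have dimfull : \dim {: 'cV[R]_d} = d by rewrite dimvf dim_matrix; exact: muln1.
have D0 : D 0%N.
  by exists (a - 1), 0%VS; rewrite dimv0; split=> //; apply: low;
    rewrite ltrBlDr ltrDl.
have Dd : D d.
  by exists (b + 1), fullv; split=> //; apply: high; rewrite ltrDl.
(* The dimensions that occur, in increasing order; the first is 0 and the last is [d], by the
   extreme values of [gamma]. *)
pose s := [seq j <- iota 0 d.+1 | `[<D j>]].
have sE0 : s = 0%N :: [seq j <- iota 1 d | `[<D j>]].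
  by rewrite /s /=; case: asboolP.
have sEd : s = rcons [seq j <- iota 0 d | `[<D j>]] d.
  by rewrite /s -addn1 iotaD filter_cat /= add0n asboolT// cats1.
have sP j : (j \in s) = `[<D j>].
  rewrite mem_filter mem_iota add0n /= ltnS; case: asboolP => //=.
  move=> [g [L [_ <-]]].
  by rewrite -[leqRHS]dimfull dimvS// subvf.
have s_sorted i j : (i < j < size s)%N -> (nth 0%N s i < nth 0%N s j)%N.
  move=> /andP[ij js]; apply: (sorted_ltn_nth ltn_trans) => //.
  - by rewrite sorted_filter ?iota_ltn_sorted//; exact: ltn_trans.
  - by rewrite inE (ltn_trans ij).
have size_s : size s = (size s).-1.+1 by rewrite sE0.
have /choice[V hV] i : exists L, (i < size s)%N ->
    exists2 gamma, splits A gamma L & \dim L = nth 0%N s i.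
  case: (ltnP i (size s)) => [si|_]; last by exists 0%VS.
  have := mem_nth 0%N si; rewrite sP => /asboolP[g [L [gL dimL]]].
  by exists L => _; exists g.
(* The spaces for two values of gamma are nested, so equal dimension makes them equal. *)
have V_uniq i gamma L : (i < size s)%N -> splits A gamma L ->
    \dim L = nth 0%N s i -> L = V i.
  move=> si gL dimL; have [g' g'V dimV] := hV i si.
  have [gg'|/ltW g'g] := leP gamma g'.
    by apply/eqP; rewrite eqEdim dimL dimV leqnn (splits_le gL g'V gg').
  by apply/esym/eqP; rewrite eqEdim dimL dimV leqnn (splits_le g'V gL g'g).
exists (size s).-1, V; split.
(* The entries 0 and [d] of [s] are distinct, so [l] is at least 1; [s] has at most [d.+1] entries,
   so [l] is at most [d]. *)
- apply/andP; split; rewrite -ltnS -size_s.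
    have : d \in s by rewrite sP asboolT.
    rewrite sE0 /= inE gtn_eqF//= ltnS.
    by case: [seq _ <- _ | _].
  by rewrite -[d.+1](size_iota 0) size_filter count_size.
- have [_ _ /eqP] := hV 0%N ltac:(by rewrite sE0).
  by rewrite {1}sE0 /= dimv_eq0 => /eqP.
- have [_ _ dimV] := hV (size s).-1 ltac:(by rewrite -size_s).
  apply/eqP; rewrite eqEdim subvf dimfull dimV nth_last sEd last_rcons leqnn//.
- move=> i j /andP[ij jl]; have js : (j < size s)%N by rewrite size_s.
  have [_ _ ->] := hV i (ltn_trans ij js); have [_ _ ->] := hV j js.
  by rewrite s_sorted// ij.
- split=> [i il|gamma L gL].
    by have [g gV _] := hV i ltac:(by rewrite size_s); exists g.
  have Ls : \dim L \in s by rewrite sP; apply/asboolP; exists gamma, L.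
  exists (index (\dim L) s); first by rewrite -ltnS -size_s index_mem.
  by apply: V_uniq gL _; rewrite ?index_mem ?nth_index.
Qed.

(** * Spectral intervals and the filtration *)

Theorem theorem20 (R : realType) (d : nat) (hd : (1 <= d)%N)
    (A : nat -> 'M[R]_d) (hA : lyapunov_sequence A) :
  exists (l : nat) (alpha beta : nat -> R),
    [/\ (1 <= l <= d)%N,
        forall i : nat, (1 <= i <= l)%N -> alpha i <= beta i,
        forall i : nat, (1 <= i < l)%N -> beta i < alpha i.+1,
        bohl_spectrum A =
          \bigcup_(i in [set i : nat | (1 <= i <= l)%N]) `[alpha i, beta i]%classic
      & exists V : nat -> {vspace 'cV[R]_d},
          [/\ V 0%N = 0%VS,
              V l = fullv,
              forall i : nat, (i < l)%N -> (V i <= V i.+1)%VS /\ V i != V i.+1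
            & forall i : nat, (i <= l)%N ->
              forall gamma : R, spectral_gap l alpha beta i gamma ->
                [set x0 : 'cV[R]_d | x0 \in V i] =
                [set x0 : 'cV[R]_d |
                  expR (- gamma * n%:R) *: solution A x0 n @[n --> \oo] --> (0 : 'cV[R]_d)]]].
Proof.
have [l [V [/andP[l1 ld] V0 Vl Vdim [Vne Vall]]]] := splits_chain hd hA.
pose P i : set R := [set gamma | splits A gamma (V i)].
have ne i : (i <= l)%N -> P i !=set0 by move=> /Vne[g gV]; exists g.
(* The opposite order would put [V j] inside [V i], against their dimensions. *)
have P_lt i j g g' : (i < j <= l)%N -> P i g -> P j g' -> g < g'.
  move=> ijl gi gj; rewrite ltNge; apply/negP => g'g.
  by have := dimvS (splits_le gj gi g'g); rewrite leqNgt Vdim.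
have below g : exists2 x, P 0%N x & x <= g.
  have [a ha] := splits_small hA; exists (Num.min a g - 1).
    by rewrite /P /= V0; apply: ha; rewrite ltrBlDr ltr_pwDr// ge_min lexx.
  by rewrite lerBlDr ler_wpDr// ge_min lexx orbT.
have above g : exists2 x, P l x & g < x.
  have [b hb] := splits_large hA; exists (Num.max b g + 1).
    by rewrite /P /= Vl; apply: hb; rewrite ltr_pwDr// le_max lexx.
  by rewrite ltr_pwDr// le_max lexx orbT.
(* The [i]-th spectral interval fills the space between the resolvent components [P i.-1] and
   [P i]. *)
pose alpha i := sup (P i.-1); pose beta i := inf (P i).
have ubP i : (i < l)%N -> has_ubound (P i).
  move=> il; have [g' g'P] := ne _ il; exists g' => g gP.
  by rewrite ltW// (P_lt i i.+1)// ltnSn.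
have lbP i : (i < l)%N -> has_lbound (P i.+1).
  move=> il; have [g' g'P] := ne _ (ltnW il); exists g' => g gP.
  by rewrite ltW// (P_lt i i.+1)// ltnSn.
(* As [P i] is open, it contains a midpoint beyond [g]; hence the supremum is not attained. *)
have lt_alpha i g : (i < l)%N -> P i g -> g < alpha i.+1.
  move=> il gP; have [a [b [ag gb hab]]] := splits_open gP.
  apply: (@lt_le_trans _ _ ((g + b) / 2)); first by rewrite midf_lt.
  apply: ub_le_sup; first exact: ubP.
  by apply: hab; rewrite (lt_trans ag) midf_lt.
have beta_lt i g : (i < l)%N -> P i.+1 g -> beta i.+1 < g.
  move=> il gP; have [a [b [ag gb hab]]] := splits_open gP.
  apply: (@le_lt_trans _ _ ((a + g) / 2)); last by rewrite midf_lt.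
  apply: ge_inf; first exact: lbP.
  by apply: hab; rewrite midf_lt//= (lt_trans _ gb)// midf_lt.
exists l, alpha, beta; split; first by rewrite l1.
- case=> // i /= il; apply: ge_sup; first exact/ne/ltnW.
  move=> x xP; apply: lb_le_inf; first exact: ne.
  by move=> y yP; rewrite ltW// (P_lt i i.+1)// ltnSn.
(* Any point of [P i.+1] separates the two endpoints strictly. *)
- case=> // i /= il; have [g gP] := ne _ (ltnW il).
  exact: lt_trans (beta_lt _ _ (ltnW il) gP) (lt_alpha _ _ il gP).
- apply/seteqP; split=> g.
  + move=> gS; have {}gS L : ~ splits A g L.
      by move=> gL; apply: gS; apply/bohl_dichotomy_scaleP; exists L.
    (* Take the least [i] for which [P i] has a point above [g]. By convexity no point of [P i] lies
       below [g], which excludes [i = 0]; by minimality no point of [P i.-1] lies above [g]. *)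
    have ex : exists i, (i <= l)%N && `[< exists2 x, P i x & g < x >].
      by exists l; rewrite leqnn; apply/asboolP.
    case: (ex_minnP ex) => i /andP[il /asboolP[x xP gx]] imin.
    case: i il xP imin => [|i] il xP imin.
      have [y yP yg] := below g.
      by case: (gS (V 0%N)); apply: splits_convex yP xP _; rewrite yg ltW.
    exists i.+1 => //=; rewrite in_itv /=; apply/andP; split.
      apply: ge_sup => [|y yP /=]; first exact/ne/ltnW.
      rewrite leNgt; apply/negP => gy.
      suff : (i < i)%N by rewrite ltnn.
      by apply: imin; rewrite ltnW//; apply/asboolP; exists y.
    apply: lb_le_inf => [|y yP]; first exact: ne.
    rewrite leNgt; apply/negP => yg.
    by apply: (gS (V i.+1)); apply: splits_convex yP xP _; rewrite !ltW.
  (* If [g] were in some [P j], then [j <= i] would force [g < alpha i.+1], and [i < j] would force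
     [beta i.+1 < g]. *)
  + move=> [[//|i] /= il]; rewrite in_itv /= => /andP[ag gb].
    move=> /bohl_dichotomy_scaleP[L gL]; have [j jl LV] := Vall _ _ gL.
    have gj : P j g by rewrite /P /= -LV.
    have [ji|] := leqP j i.
      have [y yP] := ne _ (ltnW il).
      move: ag; rewrite leNgt => /negP; apply.
      have [jE|ltji] := eqVneq j i; first by apply: lt_alpha => //; rewrite -jE.
      apply: lt_trans (lt_alpha _ _ il yP); apply: (P_lt j i) => //.
      by rewrite ltn_neqAle ltji ji ltnW.
    rewrite leq_eqVlt => /predU1P[jE|ij];
      move: gb; rewrite leNgt => /negP; apply.
      by apply: beta_lt => //; rewrite jE.
    have [y yP] := ne _ il.
    by apply: lt_trans (beta_lt _ _ il yP) _; apply: (P_lt i.+1 j);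
      rewrite // ij.
- exists V; split=> // [i il|i il g [bg ga]].
    have dimlt : (\dim (V i) < \dim (V i.+1))%N by rewrite Vdim// ltnSn.
    split; last by apply: contraTN dimlt => /eqP <-; rewrite ltnn.
    have [x xP] := ne _ (ltnW il); have [y yP] := ne _ il.
    by rewrite (splits_le xP yP)// ltW// (P_lt i i.+1)// ltnSn.
  (* Points of [P i] on both sides of [g] come from the infimum and supremum, or from unboundedness
     at the extreme indices; convexity then gives the splitting at [g]. *)
  have [x xP xg] : exists2 x, P i x & x <= g.
    case: eqVneq bg => [-> _|i0]; first exact: below.
    by rewrite lte_fin => /inf_lt -/(_ (ne _ il))[x xP /ltW xg]; exists x.
  have [y yP gy] : exists2 y, P i y & g <= y.
    case: eqVneq ga => [-> _|_].
      by have [y yP /ltW] := above g; exists y.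
    by rewrite lte_fin => /sup_gt -/(_ (ne _ il))[y yP /ltW gy]; exists y.
  by apply: splits_stable (splits_convex xP yP _); rewrite xg.
Qed.
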